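(* Let $k$ be a field, $R=k[x,y]$ and $j>0$ an integer. Let $H=(H_0,H_1,\ldots)$ be a proper $O$-sequence, with first difference sequence $E=\Delta H=(e_0,e_1,\ldots)$. Then $H$ occurs as the Hilbert function $H(R/\overline V)$ of the ancestor algebra of a proper vector subspace $V$ of $R_j$ (that is, $0\neq V\neq R_j$) if and only if $E$ satisfies the three conditions $$e_j=e_{j+1}\ge e_{j+2}\ge\cdots,\quad\text{with } e_i=0 \text{ for all sufficiently large } i,$$ $$e_j\ge e_{j-1}\ge e_{j-2}\ge\cdots\ge e_1\ge e_0=-1,$$ $$\sum_{0\le i\le j}(e_i+1)+\sum_{i>j}e_i+c_H=j+1.$$ Each such sequence $E$ satisfying the three conditions occurs, and for a vector space $V$ of dimension $d=\sum_{0\le i\le j}(e_i+1)$.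
   Context: $R=k[x,y]$ has the standard grading; $R_i$ is the space of degree-$i$ forms ($R_i=0$ for $i<0$). For a subspace $V\subset R_j$ and $i\ge0$, $R_iV=\mathrm{span}\{hf: h\in R_i, f\in V\}\subset R_{i+j}$ and $R_{-i}V=\{f\in R_{j-i}: R_i f\subset V\}$. The ancestor ideal of $V$ is $\overline V=(V)\oplus R_{-1}V\oplus\cdots\oplus R_{-j}V$, where $(V)$ is the ideal generated by $V$; the ancestor algebra is $R/\overline V$. For a graded quotient $A$ of $R$, $H(A)_i=\dim_k A_i$. A proper $O$-sequence is a sequence $H=(1,2,\ldots,\mu,H_\mu,H_{\mu+1},\ldots)$ of non-negative integers with $\mu=\min\{i: H_i<i+1\}$ a positive integer (so $H_i=i+1$ for $i<\mu$), $\mu\ge H_\mu\ge H_{\mu+1}\ge\cdots$, and $c_H=\lim_{i\to\infty}H_i\ge 0$. The first difference sequence is $e_i=H_{i-1}-H_i$ for $i\ge1$ and $e_0=-1$. *)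

(* Defs.v *)
From Stdlib Require Import Classical_Prop.
From HB Require Import structures.
From mathcomp Require Import all_boot all_order all_algebra.
From mathcomp Require Import mpoly.

Set Implicit Arguments.
Unset Strict Implicit.
Unset Printing Implicit Defensive.

Import Order.TTheory GRing.Theory Num.Theory.
Local Open Scope ring_scope.

(* Limit in a discrete set (nat or int): the sequence is eventually l. *)
Definition stable_limit (T : Type) (u : nat -> T) (l : T) : Prop :=
  exists N : nat, forall n : nat, (N <= n)%N -> u n = l.

(* mu is the least i such that H i < i + 1. *)
Definition proper_O_sequence (H : nat -> nat) : Prop :=
  exists mu : nat,
    [/\ (0 < mu)%N,
        forall i : nat, (i < mu)%N -> H i = i.+1,
        (H mu < mu.+1)%N
      & forall i : nat, (mu <= i)%N -> (H i.+1 <= H i)%N].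

(* c_H exists; the existence of the limit is not constructive. *)
Lemma proper_O_sequence_limit (H : nat -> nat) :
  proper_O_sequence H -> exists c : nat, stable_limit H c.
Proof.
case=> mu [_ _ _ Hdec].
have [m] := ubnP (H mu); elim: m mu Hdec => // m IH mu Hdec.
rewrite ltnS => le_m.
have [[n [le_n lt_n]]|nolt] := classic (exists n, (mu <= n)%N /\ (H n < H mu)%N).
  apply: (IH n) => [i le_i|]; last exact: leq_trans lt_n le_m.
  exact: Hdec (leq_trans le_n le_i).
exists (H mu), mu => n le_n; apply/eqP; rewrite eqn_leq; apply/andP; split.
  elim: n le_n => [|n IHn]; first by rewrite leqn0 => /eqP ->.
  rewrite leq_eqVlt ltnS => /orP[/eqP -> //|le_n].
  exact: leq_trans (Hdec n le_n) (IHn le_n).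
by rewrite leqNgt; apply/negP => lt_n; apply: nolt; exists n.
Qed.

Definition first_difference (H : nat -> nat) (i : nat) : int :=
  if i is i'.+1 then (H i')%:Z - (H i'.+1)%:Z else -1.

Definition difference_conditions (E : nat -> int) (j c : nat) : Prop :=
  [/\ [/\ E j = E j.+1,
          forall i : nat, (j < i)%N -> E i.+1 <= E i
        & exists N : nat, forall i : nat, (N <= i)%N -> E i = 0],
      (forall i : nat, (i < j)%N -> E i <= E i.+1) /\ E 0%N = -1
    & exists2 s : int,
        stable_limit (fun n => \sum_(j.+1 <= i < n) E i) s
      & \sum_(0 <= i < j.+1) (E i + 1) + s + c%:Z = j.+1%:Z].

Section AncestorIdeal.
Variables (k : fieldType) (j : nat).

(* R = k[x,y] is {mpoly k[2]}, and dhomog 2 k i is R_i. *)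
Implicit Type V : {vspace dhomog 2 k j}.

Definition in_forms V (p : {mpoly k[2]}) : Prop :=
  exists2 f : dhomog 2 k j, f \in V & p = mpoly_of_dhomog f.

(* R_{-i}V; meaningful for i <= j only, since j - i is truncated. *)
Definition colon_forms V (i : nat) (p : {mpoly k[2]}) : Prop :=
  p \is (j - i)%N.-homog /\
  forall h : {mpoly k[2]}, h \is i.-homog -> in_forms V (h * p).

Definition generated_ideal V (p : {mpoly k[2]}) : Prop :=
  exists (n : nat) (h : 'I_n -> {mpoly k[2]}) (f : 'I_n -> dhomog 2 k j),
    (forall t : 'I_n, f t \in V) /\
    p = \sum_(t < n) h t * mpoly_of_dhomog (f t).

(* The sum is direct because its terms live in different degrees. *)
Definition ancestor_ideal V (p : {mpoly k[2]}) : Prop :=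
  exists (g : {mpoly k[2]}) (q : nat -> {mpoly k[2]}),
    [/\ generated_ideal V g,
        forall i : nat, (1 <= i <= j)%N -> colon_forms V i (q i)
      & p = g + \sum_(1 <= i < j.+1) q i].

End AncestorIdeal.

(* H i = dim_k A_i for A = R/I with I a homogeneous ideal: A_i is
   R_i / (I \cap R_i), and a linear map from R_i onto k^(H i) with kernel
   I \cap R_i is an isomorphism of A_i with k^(H i). *)
Definition is_hilbert_function_of_quotient (k : fieldType)
    (I : {mpoly k[2]} -> Prop) (H : nat -> nat) : Prop :=
  forall i : nat, exists phi : 'Hom(dhomog 2 k i, 'rV[k]_(H i)),
    limg phi = fullv /\
    forall f : dhomog 2 k i, phi f = 0 <-> I (mpoly_of_dhomog f).

Definition occurs_for (k : fieldType) (j : nat)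
    (V : {vspace dhomog 2 k j}) (H : nat -> nat) : Prop :=
  [/\ V != 0%VS, V != fullv
    & is_hilbert_function_of_quotient (ancestor_ideal V) H].

(* Main.v *)
(** Write [I] for the ancestor ideal of [V] and [I_i] for its degree-[i]
    component. Then [I_{i+1} = x I_i + y I_i] for [i >= j], and
    [I_{i-1} = {f | x f, y f \in I_i}] for [i <= j]. For a space [U] of forms,
    the relations [x f = y g] with [f], [g] in [U] are given by the [h] with
    [x h], [y h] in [U], so [dim R_1 U + dim R_{-1} U = 2 dim U]. This makes
    the Hilbert function of [R/I] concave below degree [j], convex above it, and
    both at [j]; the sum condition is then a telescoping identity.

    Conversely take [V] spanned by monomials, with the exponents of [y] forming
    runs of lengths [r_t] separated by gaps [g_t], the last run being followed by
    [c] unused exponents. Going up one degree lengthens each run and shortens each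
    gap by one, going down does the opposite. So the wanted Hilbert function
    prescribes, for every [n], the sums of the truncated differences [r_t - n] and
    [g_t - n], and taking for [r] and [g] the conjugates of the partitions
    [(e_j + 1, e_{j-1} + 1, ...)] and [(e_{j+1}, e_{j+2}, ...)] meets this. *)
Require Import Defs.
From HB Require Import structures.
From mathcomp Require Import all_boot all_order all_algebra.
From mathcomp Require Import mpoly zify.
Import Order.TTheory GRing.Theory Num.Theory.
Local Open Scope ring_scope.

Set Implicit Arguments.
Unset Strict Implicit.
Unset Printing Implicit Defensive.

(** * Forms in two variables *)

Definition xy (a b : nat) : 'X_{1..2} := Multinom [tuple a; b].

Lemma xyD a b a' b' : (xy a b + xy a' b')%MM = xy (a + a') (b + b').
Proof. by apply/mnmP; case=> [[|[|]]] //= i; rewrite mnmDE. Qed.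

Lemma xy_eta (m : 'X_{1..2}) : m = xy (m ord0) (m ord_max).
Proof.
by apply/mnmP; case=> [[|[|]]] //= i; [congr (m _)|congr (m _)]; apply: val_inj.
Qed.

Lemma xy_inj a b a' b' : (xy a b == xy a' b') = (a == a') && (b == b').
Proof.
apply/eqP/andP => [/mnmP e|[/eqP -> /eqP ->]] //.
by have := (e ord0, e ord_max) => -[/eqP ? /eqP ?].
Qed.

Lemma mdeg_xy a b : mdeg (xy a b) = (a + b)%N.
Proof. by rewrite mdegE big_ord_recl big_ord1. Qed.

Section Forms.
Variable k : fieldType.
Implicit Types f g h : {mpoly k[2]}.

Local Notation x := ('X_[xy 1 0] : {mpoly k[2]}).
Local Notation y := ('X_[xy 0 1] : {mpoly k[2]}).

Lemma forms_eqP f g : (forall a b, f@_(xy a b) = g@_(xy a b)) -> f = g.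
Proof. by move=> e; apply/mpolyP => m; rewrite (xy_eta m). Qed.

Lemma homogP_xy n f :
  reflect (forall a b, (a + b)%N != n -> f@_(xy a b) = 0) (f \is n.-homog).
Proof.
apply: (iffP idP) => [fn a b ab|f0].
  by apply: (dhomog_nemf_coeff fn); rewrite /= mdeg_xy.
apply/dhomogP => m; rewrite mcoeff_msupp (xy_eta m) /= mdeg_xy => nz.
by apply/eqP; apply: contraNT nz => /f0 ->.
Qed.

Lemma coef_xM f a b : (x * f)@_(xy a.+1 b) = f@_(xy a b).
Proof. by rewrite mulrC -(mcoeffMX f (xy 1 0)) xyD. Qed.

Lemma coef_yM f a b : (y * f)@_(xy a b.+1) = f@_(xy a b).
Proof. by rewrite mulrC -(mcoeffMX f (xy 0 1)) xyD. Qed.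

Lemma coef_MX0 (m u : 'X_{1..2}) f : ~~ (u <= m)%MM -> ('X_[u] * f)@_m = 0.
Proof.
move=> num; apply: contraNeq num; rewrite -mcoeff_msupp mulrC => /msuppM_le.
case/allpairsP => -[m1 m2] [_]; rewrite msuppX inE => /eqP /= -> ->.
exact: lem_addl.
Qed.

Lemma coef_xM0 f b : (x * f)@_(xy 0 b) = 0.
Proof. by apply: coef_MX0; apply/mnm_lepP => /(_ ord0). Qed.

Lemma coef_yM0 f a : (y * f)@_(xy a 0) = 0.
Proof. by apply: coef_MX0; apply/mnm_lepP => /(_ ord_max). Qed.

Lemma homog_xM n f : f \is n.-homog -> x * f \is n.+1.-homog.
Proof. by move=> fn; apply: (dhomogM (d := 1)) => //; rewrite dhomogX /= mdeg_xy. Qed.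

Lemma homog_yM n f : f \is n.-homog -> y * f \is n.+1.-homog.
Proof. by move=> fn; apply: (dhomogM (d := 1)) => //; rewrite dhomogX /= mdeg_xy. Qed.

Definition form n (c : nat -> k) : {mpoly k[2]} :=
  \sum_(b < n.+1) c b *: 'X_[xy (n - b) b].

Lemma coef_form n c a b : (form n c)@_(xy a b) = if (a + b)%N == n then c b else 0.
Proof.
rewrite /form raddf_sum /=.
under eq_bigr do rewrite mcoeffZ mcoeffX xy_inj.
case: eqP => [<-|ne].
  have lb : (b < (a + b).+1)%N by lia.
  rewrite (bigD1 (Ordinal lb)) //= addnK !eqxx mulr1 big1 ?addr0 // => i.
  rewrite -val_eqE /= => /negPf ->; by rewrite andbF mulr0.
rewrite big1 // => i _; case: eqP => [e1|]; case: eqP => [e2|] /=; rewrite ?mulr0 //.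
by have := ltn_ord i; lia.
Qed.

Lemma form_homog n c : form n c \is n.-homog.
Proof. by apply/homogP_xy => a b /negPf ne; rewrite coef_form ne. Qed.

(* In a fixed degree the exponent [b] of [y] determines the monomial. *)
Definition supported (S : pred nat) f := forall a b, f@_(xy a b) != 0 -> S b.

Lemma supported0 S f a b : supported S f -> ~~ S b -> f@_(xy a b) = 0.
Proof. by move=> fS; apply: contraNeq => /fS. Qed.

(** Multiplication by x keeps the exponent of y and multiplication by y raises it by one, so R_1
    times a span of monomials is again spanned by monomials. *)
Lemma supported_splitP (S : pred nat) n f : (forall b, S b -> (b <= n)%N) ->
  f \is n.+1.-homog ->
  supported [pred b | S b || (0 < b)%N && S b.-1] f <->
  exists f1 f2, [/\ f1 \is n.-homog, f2 \is n.-homog,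
    supported S f1, supported S f2 & f = x * f1 + y * f2].
Proof.
move=> Sn fn; split=> [fS|[f1 [f2 [f1n f2n S1 S2 ->]]] a b].
  (* Terms with b in [S] are divided by x, which is possible as b <= n; the remaining ones have b-1
     in [S] and are divided by y. *)
  exists (form n (fun b => if S b then f@_(xy (n.+1 - b) b) else 0)).
  exists (form n (fun b => if S b && ~~ S b.+1 then f@_(xy (n - b) b.+1) else 0)).
  split; try exact: form_homog.
  - by move=> a b; rewrite coef_form; case: ifP => [_|]; [case: ifP => //|]; rewrite eqxx.
  - by move=> a b; rewrite coef_form; case: ifP => [_|]; [case: ifP => [/andP[]|]|];
      rewrite ?eqxx.
  apply: forms_eqP => a b; rewrite mcoeffD.
  have [abn|ne] := eqVneq (a + b)%N n.+1; last first.
    rewrite (homogP_xy _ _ fn) // (homogP_xy _ _ (homog_xM (form_homog _ _))) //.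
    by rewrite (homogP_xy _ _ (homog_yM (form_homog _ _))) // addr0.
  have -> : a = (n.+1 - b)%N by lia.
  have S0 : ~~ (S b || (0 < b)%N && S b.-1) -> f@_(xy (n.+1 - b) b) = 0.
    by move=> nS; apply: contraNeq nS => /fS.
  case: (leqP b n) => bn.
    rewrite subSn // coef_xM coef_form subnK // eqxx.
    case: b abn bn S0 => [|b] abn bn S0; rewrite ?coef_yM0 ?addr0.
      case: ifP => Sb; rewrite ?subSn //.
      by move: S0; rewrite Sb subSn // => ->.
    have e : (n - b.+1).+1 = (n - b)%N by lia.
    rewrite subSn // e in S0 *; rewrite coef_yM coef_form subnK ?eqxx; last by lia.
    rewrite /= in S0; case: ifP => Sb /=; rewrite ?andbF ?addr0 // andbT add0r.
    by case: ifP => // Sb'; apply: S0; rewrite Sb Sb'.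
  have -> : (n.+1 - b = 0)%N by lia.
  have eb : b = n.+1 by lia.
  rewrite coef_xM0 add0r eb coef_yM coef_form eqxx; move: S0; rewrite eb subnn /=.
  have -> : S n.+1 = false by apply: contraTF (leqnn n.+1) => /Sn; lia.
  by rewrite andbT; case: ifP => Sn'; rewrite ?subnn // => ->; rewrite ?Sn'.
case: b => [|b].
  rewrite mcoeffD coef_yM0 addr0; case: a => [|a]; rewrite ?coef_xM0 ?eqxx //=.
  by rewrite coef_xM => /S1 ->.
apply: contraR; rewrite negb_or => /andP[nS nS'].
rewrite mcoeffD coef_yM (supported0 _ S2) // addr0.
by case: a => [|a]; rewrite ?coef_xM0 // coef_xM (supported0 _ S1).
Qed.

(** The case of the preceding splitting in which all exponents up to n are allowed. *)
Lemma homog_split n f : f \is n.+1.-homog ->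
  exists f1 f2, [/\ f1 \is n.-homog, f2 \is n.-homog & f = x * f1 + y * f2].
Proof.
move=> fn; have Sn b : (b <= n)%N -> (b <= n)%N by [].
have [] := supported_splitP Sn fn; case=> [|f1 [f2 [? ? _ _ ?]] _]; last by exists f1, f2.
move=> a b /=; apply: contraR => nb.
by apply/eqP/(homogP_xy _ _ fn); lia.
Qed.

Lemma supported_colonP (S S' : pred nat) f :
  (forall b, S b = S' b && S' b.+1) ->
  supported S f <-> supported S' (x * f) /\ supported S' (y * f).
Proof.
move=> SS'; split=> [fS|[xS yS] a b nz]; first split.
- by case=> [|a] b; rewrite ?coef_xM0 ?eqxx // coef_xM => /fS; rewrite SS' => /andP[].
- by move=> a [|b]; rewrite ?coef_yM0 ?eqxx // coef_yM => /fS; rewrite SS' => /andP[].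
- by rewrite SS' (xS a.+1 b) ?coef_xM // (yS a b.+1) ?coef_yM.
Qed.

Lemma xy_syzygy n f g : f \is n.+1.-homog -> x * f = y * g ->
  exists h, [/\ h \is n.-homog, f = y * h & g = x * h].
Proof.
(* [h] is f divided by y: the terms of f free of y vanish because x f = y g has none. *)
move=> fn e; pose h := form n (fun b => f@_(xy (n - b) b.+1)); exists h.
have fh : f = y * h.
  apply: forms_eqP => a [|b]; first by rewrite coef_yM0 -coef_xM e coef_yM0.
  rewrite coef_yM coef_form; case: eqP => [<-|ne]; first by rewrite addnK.
  by apply: (homogP_xy _ _ fn); lia.
split=> //; first exact: form_homog.
apply: forms_eqP => a b.
by rewrite -coef_yM -e fh mulrCA coef_yM.
Qed.

End Forms.

(** * Homogeneous components of the ancestor ideal *)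

(** Only the component of h of degree d - j contributes in degree d; the test guards against
    truncated subtraction. *)
Lemma pihomogM (k : fieldType) (j d : nat) (h f : {mpoly k[2]}) :
  f \is j.-homog ->
  pihomog mdeg d (h * f) = if (j <= d)%N then pihomog mdeg (d - j) h * f else 0.
Proof.
move=> fj; set c := RHS.
rewrite [in LHS](pihomog_partitionE (leqnn (mmeasure mdeg h))) mulr_suml raddf_sum /=.
have hom (e : nat) : pihomog mdeg e h * f \is (e + j).-homog.
  by apply: dhomogM => //; exact: pihomogP.
under eq_bigr => e _.
  rewrite (_ : pihomog mdeg d _ = if (e + j)%N == d then c else 0); last first.
    case: eqP => [ed|/eqP ne]; last by rewrite (pihomog_ne0 ne (hom e)).
    by rewrite /c -ed (pihomog_dE (hom e)) leq_addl addnK.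
  over.
rewrite /c; case: leqP => jd; last first.
  by rewrite big1 // => e _; rewrite ifN //; lia.
have [lt|ge] := ltnP (d - j) (mmeasure mdeg h).
  rewrite (bigD1 (Ordinal lt)) //= subnK // eqxx big1 ?addr0 // => e ne.
  by rewrite ifN //; apply: contra ne; rewrite -val_eqE /=; lia.
rewrite big1 => [|e _]; last by rewrite ifN //; have := ltn_ord e; lia.
rewrite (_ : pihomog mdeg (d - j) h = 0) ?mul0r //.
rewrite pihomogE big_seq_cond big1 // => m /andP[mh /eqP e].
by have := mmeasure_mnm_lt mdeg mh; rewrite e /=; lia.
Qed.

Lemma homog0_const (k : fieldType) (h : {mpoly k[2]}) :
  h \is 0.-homog -> h = (h@_0)%:MP.
Proof.
move=> h0; apply/mpolyP => m; rewrite mcoeffC.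
have [->|m0] := eqVneq m 0%MM; first by rewrite mulr1.
by rewrite mulr0 (dhomog_nemf_coeff h0) //= mdeg_eq0.
Qed.

Section Ancestor.
Variables (k : fieldType) (j : nat) (V : {vspace dhomog 2 k j}).
Implicit Types f g h : {mpoly k[2]}.

Local Notation x := ('X_[xy 1 0] : {mpoly k[2]}).
Local Notation y := ('X_[xy 0 1] : {mpoly k[2]}).

Lemma in_formsE (f : dhomog 2 k j) : in_forms V (mpoly_of_dhomog f) <-> f \in V.
Proof. by split=> [[g gV /val_inj ->]|fV] //; exists f. Qed.

Lemma in_forms_homog f : in_forms V f -> f \is j.-homog.
Proof. by case=> g _ ->; apply: dhomog_is_dhomog. Qed.

Lemma in_forms0 : in_forms V 0.
Proof. by exists 0; rewrite ?mem0v ?raddf0. Qed.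

Lemma in_formsD f g : in_forms V f -> in_forms V g -> in_forms V (f + g).
Proof.
by case=> f' f'V -> [g' g'V ->]; exists (f' + g'); rewrite ?memvD ?raddfD.
Qed.

Lemma in_formsZ c f : in_forms V f -> in_forms V (c *: f).
Proof. by case=> f' f'V ->; exists (c *: f'); rewrite ?memvZ ?linearZ. Qed.

Lemma colon_forms_0 i : colon_forms V i 0.
Proof. by split=> [|h _]; rewrite ?dhomog0 // mulr0; apply: in_forms0. Qed.

Lemma colon_formsP0 f : f \is j.-homog -> colon_forms V 0 f <-> in_forms V f.
Proof.
move=> fj; split=> [[_ /(_ 1 (dhomog1 _ _))]|fV]; rewrite ?mul1r //.
split=> [|h /homog0_const ->]; first by rewrite subn0.
by rewrite mul_mpolyC; apply: in_formsZ.
Qed.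

(** Since R_{i+1} = x R_i + y R_i, testing f against forms of degree i+1 amounts to testing x f and
    y f against forms of degree i. *)
Lemma colon_formsS i f : (i < j)%N -> f \is (j - i.+1)%N.-homog ->
  colon_forms V i.+1 f <-> colon_forms V i (x * f) /\ colon_forms V i (y * f).
Proof.
move=> ij fd; have eij : (j - i = (j - i.+1).+1)%N by lia.
split=> [[_ fV]|[[_ xV] [_ yV]]].
  split; split=> [|h hi]; rewrite ?eij ?homog_xM ?homog_yM //.
    by rewrite mulrA (mulrC h); apply: fV; apply: homog_xM.
  by rewrite mulrA (mulrC h); apply: fV; apply: homog_yM.
split=> // h /homog_split[h1 [h2 [h1i h2i ->]]].
rewrite (mulrC x) (mulrC y) mulrDl -!mulrA.
by apply: in_formsD; [apply: xV|apply: yV].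
Qed.

Lemma generated0 : generated_ideal V 0.
Proof.
by exists 0, (fun _ => 0), (fun _ => 0); split=> [[]|] //; rewrite big_ord0.
Qed.

Lemma generatedM h f : in_forms V f -> generated_ideal V (h * f).
Proof.
by case=> f' f'V ->; exists 1, (fun _ => h), (fun _ => f'); rewrite big_ord1.
Qed.

Lemma generatedD f g :
  generated_ideal V f -> generated_ideal V g -> generated_ideal V (f + g).
Proof.
case=> [n [h [u [uV ->]]]] [n' [h' [u' [u'V ->]]]].
pose sel T (a : 'I_n -> T) (b : 'I_n' -> T) (t : 'I_(n + n')) :=
  match split t with inl i => a i | inr i => b i end.
have selL T a b i : @sel T a b (lshift n' i) = a i.
  by rewrite /sel (unsplitK (inl i)).
have selR T a b i : @sel T a b (rshift n i) = b i.
  by rewrite /sel (unsplitK (inr i)).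
exists (n + n')%N, (sel _ h h'), (sel _ u u'); split.
  by move=> t; rewrite /sel; case: (split t).
rewrite big_split_ord /=.
by congr (_ + _); apply: eq_bigr => i _; rewrite ?selL ?selR.
Qed.

Lemma generated_ind (P : {mpoly k[2]} -> Prop) :
  P 0 -> (forall f g, P f -> P g -> P (f + g)) ->
  (forall h f, in_forms V f -> P (h * f)) ->
  forall g, generated_ideal V g -> P g.
Proof.
move=> P0 PD PM g [n [h [u [uV ->]]]]; elim/big_ind: _ => // t _.
by apply: PM; apply/in_formsE.
Qed.

Lemma generatedMl h g : generated_ideal V g -> generated_ideal V (h * g).
Proof.
move: g; apply: generated_ind => [|f g fV gV|h' f fV].
- by rewrite mulr0; apply: generated0.
- by rewrite mulrDr; apply: generatedD.
- by rewrite mulrA; apply: generatedM.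
Qed.

Lemma generated_low d g : (d < j)%N -> generated_ideal V g -> pihomog mdeg d g = 0.
Proof.
move=> dj; move: g; apply: generated_ind => [|f g fV gV|h f fV].
- by rewrite raddf0.
- by rewrite raddfD /= fV gV addr0.
- by rewrite (pihomogM _ _ (in_forms_homog fV)) leqNgt dj.
Qed.

Lemma generated_eq g : generated_ideal V g -> in_forms V (pihomog mdeg j g).
Proof.
move: g; apply: generated_ind => [|f g fV gV|h f fV].
- by rewrite raddf0; apply: in_forms0.
- by rewrite raddfD /=; apply: in_formsD.
rewrite (pihomogM _ _ (in_forms_homog fV)) leqnn subnn.
by rewrite (homog0_const (pihomogP _ _ _)) mul_mpolyC; apply: in_formsZ.
Qed.

Lemma generated_pihomog d g :
  generated_ideal V g -> generated_ideal V (pihomog mdeg d g).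
Proof.
move: g; apply: generated_ind => [|f g fV gV|h f fV].
- by rewrite raddf0; apply: generated0.
- by rewrite raddfD /=; apply: generatedD.
rewrite (pihomogM _ _ (in_forms_homog fV)).
by case: ifP => _; [apply: generatedM|apply: generated0].
Qed.

(** In a product h f of degree n+1 > j with f in V, the cofactor h has positive degree, so a
    variable splits off it. *)
Lemma generatedS n f : (j <= n)%N -> f \is n.+1.-homog ->
  generated_ideal V f <->
  exists f1 f2, [/\ f1 \is n.-homog, f2 \is n.-homog,
    generated_ideal V f1, generated_ideal V f2 & f = x * f1 + y * f2].
Proof.
move=> jn fn; split=> [fV|[f1 [f2 [_ _ f1V f2V ->]]]]; last first.
  by apply: generatedD; apply: generatedMl.
(* The claim is moved to the degree n+1 component of an arbitrary element, as the products in the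
   induction need not be homogeneous. *)
rewrite -(pihomog_dE fn); move: f fV {fn}; apply: generated_ind => [|f g|h f fV].
- exists 0, 0; split; rewrite ?dhomog0 ?raddf0 ?mulr0 ?addr0 //; exact: generated0.
- move=> [f1 [f2 [f1n f2n f1V f2V ef]]] [g1 [g2 [g1n g2n g1V g2V eg]]].
  exists (f1 + g1), (f2 + g2); split; rewrite ?dhomogD //; try exact: generatedD.
  by rewrite raddfD /= ef eg !mulrDr addrACA.
- rewrite (pihomogM _ _ (in_forms_homog fV)) leqW // subSn //.
  have [h1 [h2 [h1n h2n ->]]] := homog_split (pihomogP mdeg (n - j).+1 h).
  have hom h0 : h0 \is (n - j).-homog -> h0 * f \is n.-homog.
    by move=> ?; rewrite -(subnK jn) dhomogM // (in_forms_homog fV).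
  exists (h1 * f), (h2 * f); split; rewrite ?hom //; try exact: generatedM.
  by rewrite mulrDl !mulrA.
Qed.

(** In degree j - i only [q i] survives when i > 0, and only the component of [g] when i = 0. *)
Lemma ancestor_low i f : (i <= j)%N -> f \is (j - i)%N.-homog ->
  ancestor_ideal V f <-> colon_forms V i f.
Proof.
move=> ij fd; split=> [[g [q [gV qV e]]]|fV]; last first.
  case: i ij fd fV => [|i] ij fd fV.
    exists f, (fun=> 0); split=> [|? _|].
    - rewrite subn0 in fd; rewrite -(mul1r f); apply: generatedM.
      exact: (colon_formsP0 fd).1.
    - exact: colon_forms_0.
    - by rewrite big1 ?addr0.
  exists 0, (fun a => if a == i.+1 then f else 0); split=> [|a _|].
  - exact: generated0.
  - by case: eqP => [->|_] //; apply: colon_forms_0.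
  - rewrite add0r -big_mkcond big_nat1_eq ifT //.
have qd a : (1 <= a < j.+1)%N ->
    pihomog mdeg (j - i) (q a) = if a == i then q a else 0.
  move=> aj; have [qa _] := qV a aj.
  by case: eqP => [<-|ne]; [rewrite (pihomog_dE qa)|rewrite (pihomog_ne0 _ qa) //; lia].
move: e => /(congr1 (pihomog mdeg (j - i))); rewrite (pihomog_dE fd) raddfD raddf_sum /=.
rewrite (eq_big_nat _ _ qd) -big_mkcond big_nat1_eq.
case: i ij fd qd => [|i] ij fd qd ->.
  rewrite subn0 addr0; apply/colon_formsP0; first exact: pihomogP.
  exact: generated_eq.
rewrite generated_low //; last by lia.
by rewrite add0r ifT; [apply: qV|].
Qed.

(** The terms [q a] have degree j - a < j, so they do not contribute from degree j on. *)
Lemma ancestor_high n f : (j <= n)%N -> f \is n.-homog ->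
  ancestor_ideal V f <-> generated_ideal V f.
Proof.
move=> jn fn; split=> [[g [q [gV qV e]]]|fV]; last first.
  exists f, (fun=> 0); split=> [//|? _|]; first exact: colon_forms_0.
  by rewrite big1 ?addr0.
move: e => /(congr1 (pihomog mdeg n)); rewrite (pihomog_dE fn) raddfD raddf_sum /=.
rewrite big_nat_cond big1 => [->|a /andP[aj _]].
  by rewrite addr0; apply: generated_pihomog.
by have [qa _] := qV a aj; rewrite (pihomog_ne0 _ qa) //; lia.
Qed.

Lemma ancestor_eq f : f \is j.-homog -> ancestor_ideal V f <-> in_forms V f.
Proof.
by move=> fj; apply: iff_trans (colon_formsP0 fj); apply: ancestor_low; rewrite ?subn0.
Qed.

(** Together with [ancestor_eq] in degree j and [ancestor_colon] for descending, this recursion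
    determines the ideal degree by degree. *)
Lemma ancestorS i f : (j <= i)%N -> f \is i.+1.-homog ->
  ancestor_ideal V f <->
  exists f1 f2, [/\ f1 \is i.-homog, f2 \is i.-homog,
    ancestor_ideal V f1, ancestor_ideal V f2 & f = x * f1 + y * f2].
Proof.
move=> ji fi; rewrite (ancestor_high _ fi) ?leqW // (generatedS ji fi).
by split=> -[f1 [f2 [h1 h2 V1 V2 ?]]]; exists f1, f2;
  have [? ?] := ancestor_high ji h1; have [? ?] := ancestor_high ji h2; split; auto.
Qed.

Lemma ancestor_colon i f : (i < j)%N -> f \is i.-homog ->
  ancestor_ideal V f <-> ancestor_ideal V (x * f) /\ ancestor_ideal V (y * f).
Proof.
move=> ij fi; have [e e'] : (j - (j - i) = i /\ j - (j - i.+1) = i.+1)%N by lia.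
rewrite (ancestor_low (i := j - i)) ?leq_subr ?e //.
rewrite !(ancestor_low (i := j - i.+1)) ?leq_subr ?e' ?homog_xM ?homog_yM //.
by rewrite -(subnSK ij) in e *; apply: colon_formsS; rewrite ?e //; lia.
Qed.

End Ancestor.

(** * Dimension counts *)

Lemma dim_forms (k : fieldType) n : \dim {:dhomog 2 k n} = n.+1.
Proof. by rewrite dimvf /dim /= addn1 binSn. Qed.

(** * Quotients by monomial subspaces *)

Section CoefficientMap.
Variables (k : fieldType) (n : nat) (S : pred nat).

Definition omitted := [seq b <- iota 0 n.+1 | ~~ S b].

(** Coordinates on the quotient of R_n by the span of the monomials with exponent in [S]. *)
Definition omitted_coefs (f : dhomog 2 k n) : 'rV[k]_(size omitted) :=
  \row_t (mpoly_of_dhomog f)@_(xy (n - nth 0 omitted t) (nth 0 omitted t)).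

Lemma omitted_coefs_linear : linear omitted_coefs.
Proof. by move=> c f g; apply/rowP => t; rewrite !mxE linearP. Qed.

HB.instance Definition _ := GRing.isLinear.Build k (dhomog 2 k n)
  'rV[k]_(size omitted) _ omitted_coefs omitted_coefs_linear.

Lemma omittedP b : (b \in omitted) = (b <= n)%N && ~~ S b.
Proof. by rewrite mem_filter mem_iota andbC. Qed.

Lemma omitted_coefs_eq0 f :
  omitted_coefs f = 0 <-> supported S (mpoly_of_dhomog f).
Proof.
split=> [/rowP f0 a b|fS].
  have [abn|ne] := eqVneq (a + b)%N n; last first.
    by rewrite (homogP_xy _ _ (dhomog_is_dhomog f)) ?eqxx.
  apply: contraR => nS; have sb : b \in omitted by rewrite omittedP nS; lia.
  have := f0 (Ordinal (etrans (index_mem _ _) sb)); rewrite !mxE /= nth_index //.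
  by rewrite (_ : n - b = a)%N => [/eqP|]; last lia.
apply/rowP => t; rewrite !mxE; apply: supported0 fS _.
by have := mem_nth 0 (ltn_ord t); rewrite omittedP => /andP[].
Qed.

Lemma limg_omitted_coefs : limg (linfun omitted_coefs) = fullv.
Proof.
apply/vspaceP => v; rewrite memvf; apply/memv_imgP.
(* [omitted] has no repetitions, so this sum has at most one term: it puts v_t on the t-th omitted
   monomial. *)
pose c b := \sum_(t < size omitted | nth 0 omitted t == b) v 0 t.
exists (DHomog (form_homog n c)); first exact: memvf.
apply/rowP => t; rewrite lfunE mxE coef_form /=.
have := mem_nth 0 (ltn_ord t); rewrite omittedP => /andP[tn _].
rewrite subnK // eqxx /c (big_pred1 t) // => t'.
by rewrite nth_uniq // filter_uniq // iota_uniq.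
Qed.

End CoefficientMap.

Lemma supported_quotient (k : fieldType) n (S : pred nat) (d : nat) :
  size (omitted n S) = d ->
  exists phi : 'Hom(dhomog 2 k n, 'rV[k]_d), limg phi = fullv /\
  forall f, phi f = 0 <-> supported S (mpoly_of_dhomog f).
Proof.
move=> <-; exists (linfun (@omitted_coefs k n S)); split=> [|f].
  exact: limg_omitted_coefs.
by rewrite lfunE; apply: omitted_coefs_eq0.
Qed.

(** * Multiplication by the variables *)

Section MultiplicationRank.
Variables (k : fieldType) (n : nat).

Definition mulx (f : dhomog 2 k n) := DHomog (homog_xM (dhomog_is_dhomog f)).
Definition muly (f : dhomog 2 k n) := DHomog (homog_yM (dhomog_is_dhomog f)).

Lemma mulx_linear : linear mulx.
Proof. by move=> c f g; apply: val_inj; rewrite /= mulrDr scalerAr. Qed.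

Lemma muly_linear : linear muly.
Proof. by move=> c f g; apply: val_inj; rewrite /= mulrDr scalerAr. Qed.

HB.instance Definition _ := GRing.isLinear.Build k (dhomog 2 k n)
  (dhomog 2 k n.+1) _ mulx mulx_linear.
HB.instance Definition _ := GRing.isLinear.Build k (dhomog 2 k n)
  (dhomog 2 k n.+1) _ muly muly_linear.

Lemma mpolyX_neq0 (m : 'X_{1..2}) : 'X_[m] != 0 :> {mpoly k[2]}.
Proof. by rewrite -msupp_eq0 msuppX. Qed.

Lemma lker_mulx : lker (linfun mulx) == 0%VS.
Proof.
apply/lker0P => f g; rewrite !lfunE => /(congr1 val) /= /mulfI e.
exact/val_inj/e/mpolyX_neq0.
Qed.

Lemma lker_muly : lker (linfun muly) == 0%VS.
Proof.
apply/lker0P => f g; rewrite !lfunE => /(congr1 val) /= /mulfI e.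
exact/val_inj/e/mpolyX_neq0.
Qed.

(** This is R_1 U, as x and y span R_1. *)
Definition mulxy (U : {vspace dhomog 2 k n}) : {vspace dhomog 2 k n.+1} :=
  (linfun mulx @: U + linfun muly @: U)%VS.

Lemma memv_mulxy U f : f \in mulxy U <->
  exists f1 f2, [/\ f1 \in U, f2 \in U & f = mulx f1 + muly f2].
Proof.
split=> [/memv_addP[_ /memv_imgP[f1 f1U ->] [_ /memv_imgP[f2 f2U ->] ->]]|].
  by exists f1, f2; rewrite !lfunE.
move=> [f1 [f2 [f1U f2U ->]]].
by apply: memv_add; rewrite -lfunE memv_img.
Qed.

End MultiplicationRank.

Section ColonRank.
Variables (k : fieldType) (n : nat).
Variables (D : {vspace dhomog 2 k n}) (U : {vspace dhomog 2 k n.+1}).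

(** If [D] consists of all h with x h and y h in [U], the syzygy makes this space the intersection
    of x U and y U; the two inequalities below use one inclusion each. *)
Let xyD : {vspace dhomog 2 k n.+2} :=
  ((linfun (@mulx k n.+1) \o linfun (@muly k n)) @: D)%VS.

Let dim_xyD : \dim xyD = \dim D.
Proof.
apply: limg_dim_eq; apply/eqP; rewrite -subv0; apply/subvP => f.
rewrite memv_cap => /andP[_]; rewrite memv_ker lfunE /= => /eqP e.
have /eqP := e; rewrite -memv_ker (eqP (lker_mulx _ _)) memv0 -memv_ker.
by rewrite (eqP (lker_muly _ _)).
Qed.

(** Grassmann's formula, multiplication by a variable being injective. *)
Let dim_cap : (\dim (mulxy U) +
  \dim (linfun (@mulx k n.+1) @: U :&: linfun (@muly k n.+1) @: U) = (\dim U).*2)%N.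
Proof.
by rewrite dimv_sum_cap -addnn !limg_dim_eq // ?(eqP (lker_mulx _ _))
  ?(eqP (lker_muly _ _)) capv0.
Qed.

Lemma dim_mulxy_le : (forall f, f \in D -> mulx f \in U /\ muly f \in U) ->
  (\dim D + \dim (mulxy U) <= (\dim U).*2)%N.
Proof.
move=> DU; rewrite -dim_cap addnC leq_add2l -dim_xyD dimvS //.
apply/subvP => _ /memv_imgP[f fD ->]; have [xU yU] := DU f fD.
rewrite lfunE /= !(lfunE (@muly k n)) /= memv_cap memv_img //= lfunE /=.
rewrite (_ : mulx (muly f) = linfun (@muly k n.+1) (mulx f)) ?memv_img //.
by rewrite lfunE; apply: val_inj; rewrite /= mulrCA.
Qed.

Lemma dim_mulxy_ge : (forall f, mulx f \in U -> muly f \in U -> f \in D) ->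
  ((\dim U).*2 <= \dim D + \dim (mulxy U))%N.
Proof.
move=> UD; rewrite -dim_cap addnC leq_add2r -dim_xyD dimvS //.
apply/subvP => h; rewrite memv_cap => /andP[/memv_imgP[f fU ->] /memv_imgP[g gU]].
rewrite !lfunE => /(congr1 val) /= /(xy_syzygy (dhomog_is_dhomog f)).
move=> [u [un fu gu]]; pose u' := DHomog un.
have ef : f = muly u' by apply: val_inj.
have eg : g = mulx u' by apply: val_inj.
apply/memv_imgP; exists u'; first by apply: UD; rewrite -?ef -?eg.
by rewrite lfunE /= !lfunE /= -ef.
Qed.

End ColonRank.

(** * Necessity *)

Lemma ancestor0 (k : fieldType) (j : nat) (V : {vspace dhomog 2 k j}) :
  ancestor_ideal V 0.
Proof.
exists 0, (fun=> 0); split=> [|i _|]; first exact: generated0.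
  exact: colon_forms_0.
by rewrite big1 ?addr0.
Qed.

Lemma ancestor_var (k : fieldType) (j i : nat) (V : {vspace dhomog 2 k j})
    (f : {mpoly k[2]}) : f \is i.-homog -> ancestor_ideal V f ->
  ancestor_ideal V ('X_[xy 1 0] * f) /\ ancestor_ideal V ('X_[xy 0 1] * f).
Proof.
move=> fi fV; have [/ancestor_colon h|ji] := ltnP i j; first exact: (h _ _ _ fi).1.
split; apply/(ancestorS V ji).
- exact: homog_xM.
- by exists f, 0; split; rewrite ?dhomog0 ?mulr0 ?addr0 //; apply: ancestor0.
- exact: homog_yM.
- by exists 0, f; split; rewrite ?dhomog0 ?mulr0 ?add0r //; apply: ancestor0.
Qed.

Section Necessity.
Variables (k : fieldType) (j : nat) (V : {vspace dhomog 2 k j}) (H : nat -> nat).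
Hypothesis HV : is_hilbert_function_of_quotient (ancestor_ideal V) H.

(** The kernel of the map witnessing [H i] presents I_i as a subspace of R_i, which has dimension
    i+1. *)
Lemma ancestor_component i : exists W : {vspace dhomog 2 k i},
  (\dim W + H i = i.+1)%N /\ forall f, f \in W <-> ancestor_ideal V (mpoly_of_dhomog f).
Proof.
have [phi [phi_onto phi0]] := HV i; exists (lker phi); split=> [|f].
  have := limg_ker_dim phi fullv; rewrite capfv phi_onto dim_forms => <-.
  by rewrite dimvf /dim /= mul1n.
by rewrite memv_ker -phi0; split=> /eqP.
Qed.

(** In terms of dim I_i = i+1 - H_i this is convexity. For i < j the colon rule puts into I_i every
    form that both variables carry into I_{i+1}, and R_1 I_{i+1} always lies in I_{i+2}. *)
Lemma hilbert_convex i : (i.+1 <= j)%N -> (H i + H i.+2 <= (H i.+1).*2)%N.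
Proof.
move=> ij; have [D [dD memD]] := ancestor_component i.
have [U [dU memU]] := ancestor_component i.+1.
have [W [dW memW]] := ancestor_component i.+2.
have UD f : mulx f \in U -> muly f \in U -> f \in D.
  rewrite !memU memD => xU yU.
  by apply/(ancestor_colon V ij) => //; apply: dhomog_is_dhomog.
have UW : (mulxy U <= W)%VS.
  apply/subvP => f /memv_mulxy[f1 [f2 [/memU f1U /memU f2U ->]]].
  have [x1 _] := ancestor_var (dhomog_is_dhomog f1) f1U.
  have [_ y2] := ancestor_var (dhomog_is_dhomog f2) f2U.
  by rewrite memvD //; apply/memW.
by have := dim_mulxy_ge UD; have := dimvS UW; lia.
Qed.

(** Here x I_i and y I_i always lie in I_{i+1}, and for i+1 >= j the component I_{i+2} is no larger
    than R_1 I_{i+1}. *)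
Lemma hilbert_concave i : (j <= i.+1)%N -> ((H i.+1).*2 <= H i + H i.+2)%N.
Proof.
move=> ji; have [D [dD memD]] := ancestor_component i.
have [U [dU memU]] := ancestor_component i.+1.
have [W [dW memW]] := ancestor_component i.+2.
have DU f : f \in D -> mulx f \in U /\ muly f \in U.
  by rewrite !memU memD => /(ancestor_var (dhomog_is_dhomog f)).
have WU : (W <= mulxy U)%VS.
  apply/subvP => f /memW /(ancestorS V ji (dhomog_is_dhomog f)).
  move=> [f1 [f2 [f1i f2i f1V f2V e]]]; apply/memv_mulxy.
  exists (DHomog f1i), (DHomog f2i); split; try exact/memU.
  exact: val_inj.
by have := dim_mulxy_le DU; have := dimvS WU; lia.
Qed.

End Necessity.

(** * From second differences to the three conditions *)

Lemma sum_first_difference (H : nat -> nat) n m : (n <= m)%N ->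
  \sum_(n.+1 <= i < m.+1) first_difference H i = (H n)%:Z - (H m)%:Z.
Proof.
move=> nm; rewrite big_add1 /=.
rewrite -[RHS]opprB -(telescope_sumr (fun i => (H i)%:Z)) // -sumrN.
by apply: eq_bigr => i _; rewrite opprB.
Qed.

Lemma sum_first_difference1 (H : nat -> nat) n : H 0%N = 1%N ->
  \sum_(0 <= i < n.+1) (first_difference H i + 1) = n.+1%:Z - (H n)%:Z.
Proof.
move=> H0; rewrite big_split /= big_nat_recl //= sumr_const_nat subn0.
have := sum_first_difference H (leq0n n); rewrite big_add1 /= => ->.
rewrite H0 -[_%:R in LHS]/(n.+1%:R) natz; lia.
Qed.

Lemma difference_conditions_of_second_differences (H : nat -> nat) j c :
  H 0%N = 1%N -> (H 1%N <= 2)%N -> (0 < j)%N -> stable_limit H c ->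
  (forall i, (i.+1 <= j)%N -> (H i + H i.+2 <= (H i.+1).*2)%N) ->
  (forall i, (j <= i.+1)%N -> ((H i.+1).*2 <= H i + H i.+2)%N) ->
  difference_conditions (first_difference H) j c.
Proof.
move=> H0 H1 j0 [N HN] convex concave; split; first split.
(* Both inequalities apply at i+1 = j and give e_j = e_{j+1}. *)
- case: j j0 convex concave => // j _ /(_ j (leqnn _)) h1 /(_ j (leqnn _)) h2 /=.
  by lia.
- by case=> // i ji /=; have := concave i (ltnW ji); lia.
- exists N.+1 => -[|i] //= ?; by rewrite !HN //; lia.
(* For i = 0 the claim is H_1 <= 2, because e_0 = -1 and H_0 = 1. *)
- split=> // -[|i] ij /=; first by lia.
  by have := convex i (ltnW ij); lia.
(* The tail telescopes to H_j - c and the sum up to j to j+1 - H_j. *)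
exists ((H j)%:Z - c%:Z).
  exists (maxn N j).+1 => -[|n] //; rewrite ltnS geq_max => /andP[Nn jn].
  by rewrite sum_first_difference // (HN n).
by rewrite sum_first_difference1 //; lia.
Qed.

(** * Runs and conjugate partitions *)

Section Runs.
Local Open Scope nat_scope.
Variables (j rl : nat).
Implicit Types L : seq (nat * nat).

(* Exponents of [y] in degree [i]: the runs of lengths [r] in degree [j], each
   with the gap [g] after it, keep their left ends and have length [r + i - j],
   truncated at 0. The last run, of length [rl], has no gap after it. *)
Fixpoint runs L (i b : nat) : bool :=
  if L is (r, g) :: L' then
    (b < r + i - j) || (r + g <= b) && runs L' i (b - (r + g))
  else (b < rl + i - j).

Definition runs_length L := (\sum_(p <- L) (p.1 + p.2) + rl).

Lemma runs_bound L i b : runs L i b -> (b + j < runs_length L + i).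
Proof.
rewrite /runs_length; elim: L b => [|[r g] L IH] b /=; first by rewrite big_nil; lia.
by rewrite big_cons /= => /orP[|/andP[pb /IH]]; lia.
Qed.

(** Up to degree j the positive gaps keep the runs apart, so b and b+1 lie in a common run of degree
    i+1; dropping the last exponent of each run leads back to degree i. *)
Lemma runs_colon L i b : all (fun p => 0 < p.2) L -> (i < j) ->
  runs L i b = runs L i.+1 b && runs L i.+1 b.+1.
Proof.
move=> + ij; elim: L b => [|[r g] L IH] b /=; first by lia.
move=> /andP[g0 /IH{}IH]; have [pb|bp] := leqP (r + g) b.
  rewrite (leqW pb) subSn // IH /=.
  have [-> [-> ->]] : (b < r + i - j) = false /\ (b < r + i.+1 - j) = false /\
    (b.+1 < r + i.+1 - j) = false by lia.
  by [].
by rewrite /= orbF; case: (runs L _ _); lia.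
Qed.

(** From degree j on no run is empty, so adding the shift by one lengthens each run by one at its
    right end; runs that meet simply overlap. *)
Lemma runsS L i b : all (fun p => 0 < p.1) L -> (0 < rl) -> (j <= i) ->
  runs L i.+1 b = runs L i b || (0 < b) && runs L i b.-1.
Proof.
move=> + rl0 ji; elim: L b => [|[r g] L IH] b /=; first by lia.
move=> /andP[r0 /IH{}IH]; have [pb|bp] := leqP (r + g) b; last by lia.
rewrite IH /= (_ : b.-1 - (r + g) = (b - (r + g)).-1); last by lia.
by case: (runs L i (b - (r + g))); case: (runs L i _.-1); lia.
Qed.

(** Needed for counting gaps: by degree j+n a run outgrows its gap by at most n exponents, all of
    them already in the next run. *)
Lemma runs_initial L n b : (b < n) -> runs L (j + n) b.
Proof. by case: L => [|[r g] L] /= bn; first lia; apply/orP; left; lia. Qed.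

Lemma count_ltn m N : count (fun b => b < m) (iota 0 N) = minn m N.
Proof.
by elim: N => [|N IH]; rewrite ?minn0 // -addn1 iotaD count_cat IH /=; lia.
Qed.

Lemma count_iotaD (P : pred nat) m n :
  count P (iota 0 (m + n)) = (count P (iota 0 m) + count (fun b => P (m + b)) (iota 0 n)).
Proof. by rewrite iotaD count_cat add0n -[in iota m n](addn0 m) iotaDl count_map. Qed.

(** At or below degree j the runs are disjoint, so their truncated lengths add up. *)
Lemma count_runs_low L n : (n <= j) ->
  count (runs L (j - n)) (iota 0 (runs_length L)) =
  (\sum_(p <- L) (p.1 - n) + (rl - n)).
Proof.
move=> nj; elim: L => [|[r g] L IH]; rewrite /runs_length ?big_nil ?big_cons.
  by rewrite /= (eq_count (a2 := fun b => b < rl - n)) ?count_ltn => [|b]; lia.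
rewrite -addnA count_iotaD -addnA -IH /=; congr addn.
  rewrite (eq_in_count (a2 := fun b => b < r - n)) ?count_ltn => [|b]; first lia.
  by rewrite mem_iota; lia.
apply: eq_count => b; rewrite leq_addr addKn /=.
by rewrite (_ : (_ < _) = false) //; lia.
Qed.

(** The window grows by n with the last run; what it misses is the truncated remainder g - n of each
    gap. *)
Lemma count_runs_high L n :
  count (predC (runs L (j + n))) (iota 0 (runs_length L + n)) =
  (\sum_(p <- L) (p.2 - n)).
Proof.
have count_geq m N : count (fun b => ~~ (b < m)) (iota 0 N) = (N - m).
  rewrite (eq_count (a2 := predC (fun b => b < m))) //.
  by have := count_predC (fun b => b < m) (iota 0 N); rewrite count_ltn size_iota; lia.
elim: L => [|[r g] L IH]; rewrite /runs_length ?big_nil ?big_cons.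
  by rewrite (eq_count (a2 := fun b => ~~ (b < rl + n))) ?count_geq => [|b] /=; lia.
rewrite -2!(addnA (_ + _)) count_iotaD /= -IH; congr addn.
  rewrite (eq_in_count (a2 := fun b => ~~ (b < r + n))) ?count_geq => [|b] /=.
    by lia.
  by rewrite mem_iota; lia.
rewrite (addnA (\sum_(p <- L) _)); apply: eq_count => b /=; rewrite leq_addr addKn /=.
case: (boolP (runs L _ _)) => [|nS]; rewrite ?orbT // orbF.
by case: (ltnP b n) => bn; [rewrite runs_initial in nS|lia].
Qed.

End Runs.

(** * Conjugate partitions *)

Section Conjugate.
Local Open Scope nat_scope.
Variables (f : nat -> nat) (N : nat).
Hypothesis f_noninc : forall i, (f i.+1 <= f i).

Definition conjugate t := (\sum_(0 <= i < N) (t < f i)).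

(** As [f] is nonincreasing, the i with t < f i form an initial segment, and subtracting n deletes
    its first n members. *)
Lemma conjugate_sub t n : (conjugate t - n = \sum_(n <= i < N) (t < f i)).
Proof.
elim: n => [|n IH]; first by rewrite subn0.
rewrite subnS IH; have [nN|Nn] := ltnP n N; last by rewrite !big_geq // ltnW.
rewrite [in LHS]big_ltn //; case: ltnP => // ft; rewrite add0n.
(* The condition fails at n, hence at all later i, and both sides are 0. *)
rewrite big_nat_cond big1 // => i /andP[/andP[ni _] _].
case: ltnP => //; rewrite ltnNge; case/negP; apply: leq_trans ft.
elim: i ni => // i IHi; rewrite ltnS leq_eqVlt => /orP[/eqP -> //|/IHi].
exact: leq_trans.
Qed.

Lemma sum_ltn m v : v <= m -> \sum_(0 <= t < m) (t < v) = v.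
Proof.
move=> vm; suff -> : \sum_(0 <= t < m) (t < v) = minn m v by lia.
elim: m {vm} => [|m IH]; first by rewrite big_geq ?min0n.
by rewrite big_nat_recr //= IH; lia.
Qed.

(** Double counting of the cells (t, i) with t < f i and i >= n. *)
Lemma sum_conjugate_sub m n : (forall i, f i <= m) ->
  \sum_(0 <= t < m) (conjugate t - n) = \sum_(n <= i < N) f i.
Proof.
move=> fm; under eq_bigr do rewrite conjugate_sub.
by rewrite exchange_big /=; apply: eq_bigr => i _; apply: sum_ltn.
Qed.

Lemma conjugate_gt0 t : 0 < N -> t < f 0 -> 0 < conjugate t.
Proof. by move=> N0 tf; rewrite /conjugate big_ltn // tf. Qed.

End Conjugate.

(** The two sums are the counts of [count_runs_low] and [count_runs_high], so these lengths produce
    H on both sides of degree j. *)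
Lemma runs_exist (H : nat -> nat) j c : H 0%N = 1%N -> stable_limit H c ->
  difference_conditions (first_difference H) j c ->
  exists rl L, [/\ (0 < rl)%N, all (fun p => 0 < p.1)%N L, all (fun p => 0 < p.2)%N L,
    forall n, (n <= j)%N ->
      (\sum_(p <- L) (p.1 - n) + (rl - n) + H (j - n)%N = (j - n).+1)%N
  & forall n, (\sum_(p <- L) (p.2 - n) + c = H (j + n))%N].
Proof.
move=> H0 [N HN] [[Ej Edec [N' EN']] [Einc E0] _].
set E := first_difference H in Ej Edec EN' Einc E0.
have PoszS (F : nat -> nat) m n :
    (\sum_(m <= i < n) F i)%N%:Z = \sum_(m <= i < n) (F i)%:Z.
  exact: (big_morph Posz PoszD).
have Ehigh i : (j < i)%N -> 0 <= E i.
  move=> ji; rewrite -(EN' (i + N')%N) ?leq_addl //.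
  elim: N' {EN'} => [|n IH]; first by rewrite addn0.
  by rewrite addnS; apply: le_trans IH; apply: Edec; lia.
have Elow i : (i <= j)%N -> -1 <= E i.
  by elim: i => [|i IH] ij; rewrite ?E0 //; apply: le_trans (Einc i ij); apply/IH/ltnW.
(* The partitions e_j + 1, e_{j-1} + 1, ... and e_{j+1}, e_{j+2}, ... in natural numbers; [Elow] and
   [Ehigh] make [absz] harmless. *)
pose a i := absz (E i + 1); pose f i := a (j - i)%N; pose g i := absz (E (j.+1 + i)%N).
have aE i : (i <= j)%N -> (a i)%:Z = E i + 1 by move=> /Elow; rewrite /a; lia.
have gE i : (g i)%:Z = E (j.+1 + i)%N by have := Ehigh (j.+1 + i)%N; rewrite /g; lia.
have f_dec i : (f i.+1 <= f i)%N.
  have [ij|ji] := ltnP i j; last by rewrite /f (_ : j - i.+1 = j - i)%N //; lia.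
  rewrite -lez_nat /f !aE ?leq_subr // lerD2r -(subnSK ij).
  by apply: Einc; lia.
have g_dec i : (g i.+1 <= g i)%N.
  by rewrite -lez_nat !gE addnS; apply: Edec; lia.
have dec_le0 (h : nat -> nat) : (forall i, h i.+1 <= h i)%N -> forall i, (h i <= h 0)%N.
  by move=> hd; elim=> // i; apply: leq_trans.
(* Since e_j = e_{j+1}, the conjugate of [f] has one part more than that of [g]: there is one run
   more than there are gaps. *)
have [e eE] : exists e, f 0%N = e.+1 /\ g 0%N = e.
  exists (g 0%N); split=> //; have := gE 0%N; have := aE j (leqnn j).
  by rewrite /f subn0 addn0 -Ej; lia.
case: eE => fe ge.
exists (conjugate f j.+1 e).
(* Terms of [g] up to index N suffice, H being constant from N on; taking N+1 of them keeps the gaps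
   positive even if N = 0. *)
exists [seq (conjugate f j.+1 t, conjugate g N.+1 t) | t <- iota 0 e]; split.
- by apply: conjugate_gt0; rewrite ?fe.
- rewrite all_map; apply/allP => t; rewrite mem_iota /= => te.
  by apply: conjugate_gt0; rewrite ?fe //; lia.
- rewrite all_map; apply/allP => t; rewrite mem_iota /= => te.
  by apply: conjugate_gt0; rewrite ?ge //; lia.
- move=> n nj; rewrite big_map -[e in iota 0 e]subn0 -big_nat_recr //=.
  rewrite sum_conjugate_sub // => [|i]; last by rewrite -fe dec_le0.
  (* Replacing i by j - i turns the sum into that of e_i + 1 over i <= j - n. *)
  rewrite -{1}[n]add0n big_addn big_nat_rev /= subSn //.
  rewrite (eq_big_nat _ _ (F2 := a)) => [|i ij]; last first.
    by rewrite /f; congr (a _); lia.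
  have : (\sum_(0 <= i < (j - n).+1) a i)%N%:Z = (j - n).+1%:Z - (H (j - n)%N)%:Z.
    rewrite PoszS -sum_first_difference1 //; apply: eq_big_nat => i ij.
    by rewrite aE //; lia.
  by lia.
move=> n; rewrite big_map -[e in iota 0 e]subn0.
rewrite sum_conjugate_sub // => [|i]; last by rewrite -ge dec_le0.
have [nN|Nn] := leqP n N.+1; last first.
  by rewrite big_geq ?HN //; lia.
have : (\sum_(n <= i < N.+1) g i)%N%:Z = (H (j + n)%N)%:Z - (H (j + N.+1)%N)%:Z.
  rewrite PoszS -sum_first_difference ?leq_add2l //.
  rewrite -addSn -[(j + N.+1).+1]addSn (addnC j.+1 n) (addnC j.+1 N.+1) big_addn addnK.
  by apply: eq_bigr => i _; rewrite gE addnC.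
by rewrite (HN (j + N.+1)%N); lia.
Qed.

(** * Monomial ancestor ideals *)

Section Monomial.
Variables (k : fieldType) (j rl : nat) (L : seq (nat * nat)).
Hypotheses (rl_gt0 : (0 < rl)%N) (runs_gt0 : all (fun p => 0 < p.1)%N L).
Hypotheses (gaps_gt0 : all (fun p => 0 < p.2)%N L) (len : (runs_length rl L <= j.+1)%N).
Variable V : {vspace dhomog 2 k j}.
Hypothesis memV : forall f, f \in V <-> supported (runs j rl L j) (mpoly_of_dhomog f).

(** Ideal and runs agree in degree j and obey the same recursions away from it: [ancestor_colon]
    matches [runs_colon], and [ancestorS] matches [runsS]. *)
Lemma ancestor_runs i (f : {mpoly k[2]}) : f \is i.-homog ->
  ancestor_ideal V f <-> supported (runs j rl L i) f.
Proof.
have base (g : {mpoly k[2]}) : g \is j.-homog ->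
    ancestor_ideal V g <-> supported (runs j rl L j) g.
  move=> gj; apply: iff_trans (ancestor_eq V gj) _.
  by apply: iff_trans (memV (DHomog gj)); apply: in_formsE V (DHomog gj).
have [ij|ji] := leqP i j.
  have [n e] : exists n, i = (j - n)%N /\ (n <= j)%N by exists (j - i)%N; lia.
  case: e => -> {i ij}; elim: n f => [|n IH] f nj fi.
    by rewrite subn0 in fi *; apply: base.
  have ij : (j - n.+1 < j)%N by lia.
  have eS : (j - n.+1).+1 = (j - n)%N by lia.
  apply: iff_trans (ancestor_colon V ij fi) _.
  apply: iff_trans (iff_sym (supported_colonP _ (fun b => runs_colon _ _ gaps_gt0 ij))).
  rewrite eS.
  have hom (g : {mpoly k[2]}) : g \is (j - n.+1).+1.-homog -> g \is (j - n)%N.-homog.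
    by rewrite eS.
  have [? ?] := IH _ (ltnW nj) (hom _ (homog_xM fi)).
  have [? ?] := IH _ (ltnW nj) (hom _ (homog_yM fi)).
  by split=> -[]; auto.
have [n ->] : exists n, i = (j + n)%N by exists (i - j)%N; lia.
move: f; elim: n {i ji} => [|n IH] f; first by rewrite addn0; apply: base.
rewrite addnS => fi; apply: iff_trans (ancestorS V (leq_addr n j) fi) _.
have bound b : runs j rl L (j + n) b -> (b <= j + n)%N by move/runs_bound; lia.
have eS : supported (runs j rl L (j + n).+1) f <->
    supported [pred b | runs j rl L (j + n) b || (0 < b)%N && runs j rl L (j + n) b.-1] f.
  by split=> h a b /h /=; rewrite runsS // leq_addr.
apply: iff_trans (iff_sym eS); apply: iff_trans (iff_sym (supported_splitP bound fi)).
split=> -[f1 [f2 [h1 h2 V1 V2 ->]]]; exists f1, f2;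
  have [? ?] := IH f1 h1; have [? ?] := IH f2 h2; split; auto.
Qed.

End Monomial.

(** * Realising a given sequence *)

Lemma size_omitted n S : (size (omitted n S) + count S (iota 0 n.+1) = n.+1)%N.
Proof. by rewrite size_filter -[RHS](size_iota 0) -(count_predC S) addnC. Qed.

Lemma difference_conditions_occur (k : fieldType) (j : nat) (H : nat -> nat) (c : nat) :
  H 0%N = 1%N -> stable_limit H c ->
  difference_conditions (first_difference H) j c ->
  exists V : {vspace dhomog 2 k j}, occurs_for V H /\
    (\dim V)%:Z = \sum_(0 <= i < j.+1) (first_difference H i + 1).
Proof.
move=> H0 Hc E; have [rl [L [rl0 r0 g0 low high]]] := runs_exist H0 Hc E.
(* At n = 0 the two counts say that the runs have total length j+1 - H_j and the gaps H_j - c. *)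
have len : (runs_length rl L + c = j.+1)%N.
  have := low 0%N (leq0n j); have := high 0%N; rewrite /runs_length big_split /=.
  under eq_bigr do rewrite subn0; under [in X in _ -> X]eq_bigr do rewrite subn0.
  by rewrite !subn0 addn0; lia.
have sizeH i : size (omitted i (runs j rl L i)) = H i.
  (* Occupied exponents in degree i stay below [runs_length] + i - j, so widening the window adds
     none. *)
  have beyond m n : (runs_length rl L + i <= m + j)%N ->
      count (runs j rl L i) (iota 0 (m + n)) = count (runs j rl L i) (iota 0 m).
    move=> lm; rewrite count_iotaD [X in (_ + X)%N](_ : _ = 0%N) ?addn0 //.
    by apply/eqP; rewrite -leqn0 leqNgt -has_count; apply/hasPn => b _;
      apply: contraL lm => /runs_bound; lia.
  have := size_omitted i (runs j rl L i).
  have [ij|ji] := leqP i j.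
    have := low (j - i)%N (leq_subr _ _); rewrite subKn // => e.
    have := count_runs_low rl L (leq_subr i j); rewrite subKn //.
    rewrite -(beyond _ c) ?leq_add2l // len.
    by rewrite -[j.+1](subnKC (_ : i.+1 <= j.+1)%N) // beyond; lia.
  have [n e] : exists n, i = (j + n)%N by exists (i - j)%N; lia.
  (* The i+1 exponents are a window of length [runs_length] + n followed by c unoccupied ones, which
     accounts for the summand c in [high]. *)
  have := count_runs_high j rl L n; have := high n; rewrite -e.
  have := count_predC (runs j rl L i) (iota 0 (runs_length rl L + n)).
  rewrite size_iota -(beyond _ c); last by lia.
  by rewrite (_ : runs_length rl L + n + c = i.+1)%N; lia.
have [phi [phi_onto phi0]] := supported_quotient k (sizeH j).
pose V := lker phi.
have memV f : f \in V <-> supported (runs j rl L j) (mpoly_of_dhomog f).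
  by rewrite memv_ker -phi0; split=> /eqP.
have len' : (runs_length rl L <= j.+1)%N by rewrite -len leq_addr.
have dimV : (\dim V + H j = j.+1)%N.
  have := limg_ker_dim phi fullv; rewrite capfv phi_onto dim_forms => <-.
  by rewrite dimvf /dim /= mul1n.
(* This makes V proper. A gap has positive length and is counted in H_j; without gaps, H_0 = 1
   forces rl <= j, hence c > 0. *)
have Hj_gt0 : (0 < H j)%N.
  have := low j (leqnn j); rewrite subnn H0; have := high 0%N; rewrite addn0.
  move: len g0; rewrite /runs_length; case: (L) => [|[r g] L'].
    by rewrite !big_nil; lia.
  by rewrite !big_cons /= => _ /andP[g0 _]; lia.
exists V; split; last by rewrite sum_first_difference1 // -dimV PoszD addrK.
split.
- rewrite -dimv_eq0 -lt0n -(ltn_add2r (H j)) dimV.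
  by have := low 0%N (leq0n j); rewrite !subn0; lia.
- by apply: contraTneq Hj_gt0 => eV; move: dimV; rewrite eV dim_forms; lia.
move=> i; have [psi [psi_onto psi0]] := supported_quotient k (sizeH i).
exists psi; split=> // f; apply: iff_trans (psi0 f) _.
apply: iff_sym; apply: (ancestor_runs rl0 r0 g0 len' memV).
exact: dhomog_is_dhomog.
Qed.

Theorem theoremA (k : fieldType) (j : nat) (j_gt0 : (0 < j)%N)
    (H : nat -> nat) (c : nat)
    (H_proper : proper_O_sequence H) (H_limit : stable_limit H c) :
  ((exists V : {vspace dhomog 2 k j}, occurs_for V H) <->
     difference_conditions (first_difference H) j c)
  /\
  (difference_conditions (first_difference H) j c ->
   exists V : {vspace dhomog 2 k j},
     occurs_for V H /\
     (\dim V)%:Z = \sum_(0 <= i < j.+1) (first_difference H i + 1)).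
Proof.
have H0 : H 0%N = 1%N by have [mu [mu0 Hmu _ _]] := H_proper; apply: Hmu.
have occur := @difference_conditions_occur k j H c H0 H_limit.
split=> //; split=> [[V [_ _ HV]]|E]; last first.
  by have [V [HV _]] := occur E; exists V.
apply: difference_conditions_of_second_differences => //.
- by have [W [? _]] := ancestor_component HV 1; lia.
- by move=> i; apply: (hilbert_convex HV).
- by move=> i; apply: (hilbert_concave HV).
Qed.
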